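(* Let $\mathfrak{H}$ be a separable complex Hilbert space and $\alpha\in[0,1)$. Assume that the operator $J$ acting in $\mathfrak{H}$ is m-accretive, that $J^{-1}$ is compact, that $F\in\mathcal{B}(\mathfrak{H})$, and that $G$ is a bounded, strictly accretive operator with $\mathrm{D}(G)\supset\mathrm{R}(J)$ and with lower bound $$\gamma_{G}>C_{\alpha}\,\|J^{-1}\|\cdot\|F\| ,$$ where $C_{\alpha}$ is the constant given by the formula $C_{1-\beta}=2(1-\beta)^{-1}\|J^{-1}\|+\beta^{-1}$, $\beta\in(0,1)$; that is, $C_{\alpha}=2\alpha^{-1}\|J^{-1}\|+(1-\alpha)^{-1}$ for $\alpha\in(0,1)$ (for $\alpha=0$ no value of the constant is specified; that case is only described as trivial, because $J^{-1}$ is bounded). Then the operator $$L:=Z^{\alpha}_{G,F}(J):=J^{*}GJ+FJ^{\alpha}$$ satisfies the following two conditions. (H1) There exist a Hilbert space $\mathfrak{H}_{+}\subset\subset\mathfrak{H}$ and a linear manifold $\mathfrak{M}$ that is dense in $\mathfrak{H}_{+}$, such that $L$ is defined on $\mathfrak{M}$. (H2) There are constants $C_{1},C_{2}>0$ such that $|(Lf,g)_{\mathfrak{H}}|\le C_{1}\|f\|_{\mathfrak{H}_{+}}\|g\|_{\mathfrak{H}_{+}}$ and $\mathrm{Re}(Lf,f)_{\mathfrak{H}}\ge C_{2}\|f\|^{2}_{\mathfrak{H}_{+}}$ for all $f,g\in\mathfrak{M}$.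
   Context: All operators are linear. $\mathrm{D}(\cdot)$ and $\mathrm{R}(\cdot)$ denote the domain and range, $\mathcal{B}(\mathfrak{H})$ the set of bounded linear operators on $\mathfrak{H}$. $\mathfrak{H}_{+}\subset\subset\mathfrak{H}$ means: $\mathfrak{H}_{+}$ is dense in $\mathfrak{H}$ as a set of elements, $\|f\|_{\mathfrak{H}}\le C\|f\|_{\mathfrak{H}_{+}}$ for $f\in\mathfrak{H}_{+}$ with some constant $C>0$, and every set bounded in the norm of $\mathfrak{H}_{+}$ is (relatively) compact in the norm of $\mathfrak{H}$. An operator $T$ is m-accretive if $(T+\zeta)^{-1}\in\mathcal{B}(\mathfrak{H})$ and $\|(T+\zeta)^{-1}\|\le(\mathrm{Re}\,\zeta)^{-1}$ for all $\mathrm{Re}\,\zeta>0$. $T$ is strictly accretive with lower bound $\gamma_{T}>0$ if $\mathrm{Re}(Tf,f)_{\mathfrak{H}}\ge\gamma_{T}\|f\|^{2}_{\mathfrak{H}}$ for $f\in\mathrm{D}(T)$. For $\alpha\in(0,1)$ the positive fractional power of an m-accretive operator $J$ is defined by $$J^{\alpha}=\frac{\sin\alpha\pi}{\pi}\int_{0}^{\infty}\lambda^{\alpha-1}(\lambda+J)^{-1}J\,d\lambda$$ (with the usual extension of this definition from positive operators to m-accretive operators), and $J^{0}=I$. The constant $C_{1-\beta}$ above is the one in the bound $\|J^{-\beta}f\|_{\mathfrak{H}}\le C_{1-\beta}\|f\|_{\mathfrak{H}}$, $f\in\mathfrak{H}$, $\beta\in(0,1)$, where $J^{-\beta}=\frac{\sin\beta\pi}{\pi}\int_{0}^{\infty}\lambda^{-\beta}(\lambda+J)^{-1}\,d\lambda$.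 *)

(* Defs.v *)
From Stdlib Require Import Reals.
From Coquelicot Require Import Coquelicot.

Set Implicit Arguments.
Unset Strict Implicit.
Unset Printing Implicit Defensive.

Open Scope R_scope.

(** * Restriction of scalars from [C] to [R]

    [is_RInt_gen] integrates functions with values in a normed module over [R];
    the space is unchanged as a group and as a uniform space. *)

Section RestrictScalars.

Variable V : NormedModule C_AbsRing.

Definition real_scal (r : R) (x : V) : V := scal (RtoC r : C_AbsRing) x.

Lemma real_scal_assoc (x y : R_Ring) (u : V) :
  real_scal x (real_scal y u) = real_scal (mult x y) u.
Proof.
  unfold real_scal. rewrite scal_assoc. f_equal.
  symmetry; exact (RtoC_mult x y).
Qed.

Lemma real_scal_one (u : V) : real_scal (@one R_Ring) u = u.
Proof. exact (scal_one u). Qed.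

Lemma real_scal_distr_l (x : R_Ring) (u v : V) :
  real_scal x (plus u v) = plus (real_scal x u) (real_scal x v).
Proof. exact (scal_distr_l _ u v). Qed.

Lemma real_scal_distr_r (x y : R_Ring) (u : V) :
  real_scal (plus x y) u = plus (real_scal x u) (real_scal y u).
Proof.
  transitivity (scal (plus (RtoC x : C_AbsRing) (RtoC y)) u).
  - apply (f_equal (fun z : C_AbsRing => scal z u)); exact (RtoC_plus x y).
  - exact (scal_distr_r (RtoC x : C_AbsRing) (RtoC y) u).
Qed.

Definition real_ModuleSpace_mixin : ModuleSpace.mixin_of R_Ring V :=
  ModuleSpace.Mixin R_Ring V real_scal real_scal_assoc real_scal_one
    real_scal_distr_l real_scal_distr_r.

Definition real_NormedModuleAux : NormedModuleAux R_AbsRing :=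
  NormedModuleAux.Pack R_AbsRing V
    (NormedModuleAux.Class R_AbsRing V
      (ModuleSpace.Class R_Ring V (AbelianGroup.class V) real_ModuleSpace_mixin)
      (UniformSpace.class V)) V.

Lemma real_norm_scal (l : R) (x : V) :
  norm (real_scal l x) <= Rabs l * norm x.
Proof.
  unfold real_scal. rewrite <- Cmod_R. exact (norm_scal (RtoC l : C_AbsRing) x).
Qed.

Definition real_NormedModule_mixin :
    NormedModule.mixin_of R_AbsRing real_NormedModuleAux :=
  NormedModule.Mixin R_AbsRing real_NormedModuleAux
    (@norm C_AbsRing V) (@norm_factor C_AbsRing V)
    (@norm_triangle C_AbsRing V) real_norm_scal
    (@norm_compat1 C_AbsRing V) (@norm_compat2 C_AbsRing V)
    (@norm_eq_zero C_AbsRing V).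

Definition real_NormedModule : NormedModule R_AbsRing :=
  NormedModule.Pack R_AbsRing V
    (NormedModule.Class R_AbsRing V
      (NormedModuleAux.Class R_AbsRing V
        (ModuleSpace.Class R_Ring V (AbelianGroup.class V)
          real_ModuleSpace_mixin)
        (UniformSpace.class V))
      real_NormedModule_mixin) V.

End RestrictScalars.

(** * Complex Hilbert spaces *)

(** The inner product is linear in its first argument. Positivity and
    definiteness follow from [inner_norm]. *)
Record Hilbert : Type := mkHilbert {
  hilbert_car :> CompleteNormedModule C_AbsRing;
  inner : hilbert_car -> hilbert_car -> C;
  inner_plus : forall x y z,
    inner (plus x y) z = Cplus (inner x z) (inner y z);
  inner_scal : forall (a : C) x y, inner (scal a x) y = Cmult a (inner x y);
  inner_conj : forall x y, inner y x = Cconj (inner x y);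
  inner_norm : forall x, inner x x = RtoC (norm x ^ 2)
}.

Definition dense_set (V : NormedModule C_AbsRing) (A : V -> Prop) : Prop :=
  forall (x : V) (eps : posreal), exists y, A y /\ norm (minus x y) < eps.

Definition separable (H : Hilbert) : Prop :=
  exists u : nat -> H, dense_set (fun x => exists n, x = u n).

Definition linear_manifold (V : ModuleSpace C_Ring) (M : V -> Prop) : Prop :=
  M zero /\ (forall x y, M x -> M y -> M (plus x y)) /\
  (forall (a : C_Ring) x, M x -> M (scal a x)).

Definition bounded_set (V : NormedModule C_AbsRing) (A : V -> Prop) : Prop :=
  exists r : R, forall x, A x -> norm x <= r.

Definition relatively_compact (V : NormedModule C_AbsRing) (A : V -> Prop) :
    Prop :=
  forall u : nat -> V, (forall n, A (u n)) ->
  exists (s : nat -> nat) (l : V), (forall n, (s n < s (S n))%nat) /\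
    filterlim (fun n => u (s n)) eventually (locally l).

(** Set inclusions [E] in [H] of one space in another are given by their
    inclusion map [i]; [is_linear] contains the bound [|i f| <= C |f|]. *)
Definition compact_dense_inclusion (E H : NormedModule C_AbsRing) (i : E -> H) :
    Prop :=
  is_linear i /\
  (forall x y, i x = i y -> x = y) /\
  dense_set (fun h => exists f, h = i f) /\
  (forall B : E -> Prop, bounded_set B ->
    relatively_compact (fun h => exists f, B f /\ h = i f)).

(** * Operators, given by their graphs

    [T f g] reads: [f] is in the domain of [T] and [T f = g]. *)

Section Operators.

Variable H : Hilbert.

Definition operator : Type := H -> H -> Prop.

Definition op_dom (T : operator) (f : H) : Prop := exists g, T f g.

Definition op_ran (T : operator) (g : H) : Prop := exists f, T f g.

Definition linear_operator (T : operator) : Prop :=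
  T zero zero /\
  (forall f1 f2 g1 g2, T f1 g1 -> T f2 g2 -> T (plus f1 f2) (plus g1 g2)) /\
  (forall (a : C_Ring) f g, T f g -> T (scal a f) (scal a g)) /\
  (forall f g1 g2, T f g1 -> T f g2 -> g1 = g2).

Definition op_scalar (z : C_Ring) : operator := fun f g => g = scal z f.

Definition op_id : operator := fun f g => g = f.

Definition op_add (S T : operator) : operator := fun f h =>
  exists g1 g2, S f g1 /\ T f g2 /\ h = plus g1 g2.

Definition op_comp (S T : operator) : operator := fun f h =>
  exists g, T f g /\ S g h.

Definition op_inv (T : operator) : operator := fun f g => T g f.

(** The graph of an operator when [T] is densely defined. *)
Definition op_adjoint (T : operator) : operator := fun g h =>
  forall f k, T f k -> inner k g = inner f h.

Definition op_closure (T : operator) : operator := fun f g =>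
  forall eps : posreal, exists f' g',
    T f' g' /\ norm (minus f f') < eps /\ norm (minus g g') < eps.

Definition op_graph (A : H -> H) : operator := fun f g => g = A f.

(** Everywhere defined bounded operators. *)
Definition bounded_operator (T : operator) : Prop :=
  exists A : H -> H, is_linear A /\ forall f g, T f g <-> op_graph A f g.

Definition compact_operator (T : operator) : Prop :=
  bounded_operator T /\
  forall B : H -> Prop, bounded_set B ->
    relatively_compact (fun g => exists f, B f /\ T f g).

(** Meaningful for bounded operators only: [real] sends [p_infty] to [0]. *)
Definition op_norm (T : operator) : R :=
  real (Lub_Rbar (fun r => exists f g, T f g /\ norm f <= 1 /\ r = norm g)).

Definition bounded_on_domain (T : operator) : Prop :=
  exists c : R, forall f g, T f g -> norm g <= c * norm f.

Definition m_accretive (T : operator) : Prop :=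
  forall z : C, 0 < Re z ->
    bounded_operator (op_inv (op_add T (op_scalar z))) /\
    op_norm (op_inv (op_add T (op_scalar z))) <= / Re z.

Definition strictly_accretive (T : operator) (gamma : R) : Prop :=
  0 < gamma /\
  forall f g, T f g -> gamma * norm f ^ 2 <= Re (inner g f).

(** [f |-> sin(a pi)/pi * int_0^oo l^(a-1) (l + J)^(-1) J f dl], an improper
    integral converging in norm; [phi l] is [(l + J)^(-1) J f], so that [f]
    belongs to the domain of [J]. *)
Definition balakrishnan (a : R) (J : operator) : operator := fun f h =>
  exists (phi : R -> H) (v : H),
    (forall l : R, 0 < l ->
      op_comp (op_inv (op_add J (op_scalar (RtoC l)))) J f (phi l)) /\
    @is_RInt_gen (real_NormedModule H)
      (fun l => scal (RtoC (Rpower l (a - 1)) : C_AbsRing) (phi l))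
      (at_right 0) (Rbar_locally p_infty) v /\
    h = scal (RtoC (sin (a * PI) / PI) : C_AbsRing) v.

(** The integral is taken on the domain of [J], which is a core of [J^a] for
    [J] m-accretive and [0 < a < 1]. *)
Definition op_power (a : R) (J : operator) : operator :=
  if Req_EM_T a 0 then op_id else op_closure (balakrishnan a J).

(** Bounds the norm of [J^(-b)] for [b = 1 - a]. The formula, written for
    [0 < b < 1], has no value at [a = 0]; there [b = 1] and the bound of
    [J^(-1)] is its norm. *)
Definition power_const (a : R) (J : operator) : R :=
  if Req_EM_T a 0 then op_norm (op_inv J)
  else 2 * / a * op_norm (op_inv J) + / (1 - a).

(** [J^* G J + F J^a], on its natural domain. *)
Definition Z_transform (a : R) (G F J : operator) : operator :=
  op_add (op_comp (op_adjoint J) (op_comp G J)) (op_comp F (op_power a J)).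

End Operators.

(* Main.v *)
Require Import Defs.
From Stdlib Require Import Reals Lra Lia ClassicalEpsilon.
From Coquelicot Require Import Coquelicot.
Open Scope R_scope.

(** Let [A = J^(-1)]. The energy space is [D(J)] with the norm [|J f|]; it is
    [H] itself, included in [H] through the compact injection [A], whose range
    is dense because [J] is m-accretive. With [f], [g] replaced by [A f], [A g],
    the form of [L] is [(G f, g) + (F T f, A g)] with [T = J^(alpha-1)], so both
    estimates in (H2) follow from [|T| <= C_alpha]. This bound comes from
    splitting the Balakrishnan integral at [1] and using [|(l+J)^(-1)| <= 2 |A|]
    on (0,1) and [|(l+J)^(-1)| <= 1/l] on (1,oo). [L] is defined at [A f] as soon as
    [G f] lies in the range of the adjoint of [A]; such [f] are dense because
    that range is dense and [G] is onto (Lax-Milgram). *)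

(** * Hilbert space geometry *)

(** [J], its adjoint and its power are only graphs, so the argument is carried to everywhere defined
    maps by writing f = [A y]. Then (J + l) f = y + l A y: the resolvent is the map sending y + l A
    y to A y, and (l + J)^(-1) J f is the resolvent applied to y. The delicate object is the power.
    (H2) concerns every value [h] of L at [A f], while [op_power] is the graph closure of an
    integral; it must be shown that this closure has exactly one value at each [A u], bounded by a
    multiple of the norm of u. Accretivity and dense domain of J are not assumed as such: both are
    extracted from the resolvent bounds. The threshold for [gammaG] is the cost of the perturbation
    (F T f, A g): T costs [power_const], F its norm, and A on the second argument the norm of
    J^(-1). *)

Lemma Re_plus (a b : C) : Re (Cplus a b) = Re a + Re b.
Proof. reflexivity. Qed.

Lemma Re_Cconj (a : C) : Re (Cconj a) = Re a.
Proof. reflexivity. Qed.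

Lemma Re_le_Cmod (z : C) : Re z <= Cmod z.
Proof.
  apply Rle_trans with (Rabs (fst z)); [apply Rle_abs |].
  apply Rle_trans with (2 := Rmax_Cmod z). apply Rmax_l.
Qed.

(** A normed module provides only [<=]; the converse is that inequality for the inverse scalar. *)
Lemma norm_scal_C (H : NormedModule C_AbsRing) (a : C) (x : H) :
  norm (scal (a : C_AbsRing) x) = Cmod a * norm x.
Proof.
  apply Rle_antisym; [exact (norm_scal (a : C_AbsRing) x) |].
  destruct (Ceq_dec a 0) as [-> | Ha].
  { rewrite Cmod_0, Rmult_0_l. apply norm_ge_0. }
  assert (Hm : 0 < Cmod a) by (apply Cmod_gt_0; exact Ha).
  assert (Hx : x = scal (Cinv a : C_AbsRing) (scal (a : C_AbsRing) x)).
  { rewrite scal_assoc. rewrite <- (scal_one x) at 1. f_equal.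
    symmetry. exact (Cinv_l a Ha). }
  assert (Hle : norm x <= / Cmod a * norm (scal (a : C_AbsRing) x)).
  { rewrite Hx at 1. rewrite <- Cmod_inv by exact Ha.
    exact (norm_scal (Cinv a : C_AbsRing) _). }
  apply Rmult_le_compat_l with (r := Cmod a) in Hle; [| lra].
  rewrite <- Rmult_assoc, Rinv_r, Rmult_1_l in Hle by lra. exact Hle.
Qed.

Section InnerProduct.

Variable H : Hilbert.
Implicit Types x y z : H.

Lemma inner_plus_r x y z :
  inner z (plus x y) = Cplus (inner z x) (inner z y).
Proof.
  rewrite (inner_conj (plus x y) z), inner_plus, Cplus_conj.
  now rewrite <- !inner_conj.
Qed.

Lemma inner_scal_r (a : C) x y :
  inner x (scal (a : C_AbsRing) y) = Cmult (Cconj a) (inner x y).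
Proof.
  rewrite (inner_conj (scal (a : C_AbsRing) y) x), inner_scal, Cmult_conj.
  now rewrite <- inner_conj.
Qed.

Lemma inner_zero_l y : inner zero y = 0.
Proof.
  assert (h := inner_scal (RtoC 0) zero y).
  rewrite Cmult_0_l in h. rewrite <- h. f_equal.
  symmetry. exact (scal_zero_l (K := C_Ring) (zero : H)).
Qed.

Lemma inner_zero_r y : inner y zero = 0.
Proof.
  rewrite (inner_conj zero y), inner_zero_l. unfold Cconj; simpl.
  apply injective_projections; simpl; ring.
Qed.

Lemma inner_opp x y : inner (opp x) y = Copp (inner x y).
Proof.
  transitivity (Cmult (Copp 1) (inner x y)); [| ring].
  rewrite <- inner_scal. f_equal.
  symmetry. exact (scal_opp_one (K := C_Ring) x).
Qed.

Lemma inner_minus x y z : inner (minus x y) z = Cminus (inner x z) (inner y z).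
Proof. unfold minus. now rewrite inner_plus, inner_opp. Qed.

Lemma inner_minus_r x y z :
  inner z (minus x y) = Cminus (inner z x) (inner z y).
Proof.
  rewrite (inner_conj (minus x y) z), inner_minus, Cminus_conj.
  now rewrite <- !inner_conj.
Qed.

Lemma Re_inner_self x : Re (inner x x) = norm x ^ 2.
Proof. now rewrite inner_norm. Qed.

Lemma norm_plus_sq x y :
  norm (plus x y) ^ 2 = norm x ^ 2 + 2 * Re (inner x y) + norm y ^ 2.
Proof.
  rewrite <- !Re_inner_self, inner_plus, !inner_plus_r, !Re_plus.
  rewrite (inner_conj x y), Re_Cconj. ring.
Qed.

Lemma norm_minus_le x y : norm (minus x y) <= norm x + norm y.
Proof.
  eapply Rle_trans; [exact (norm_triangle (V := H) x (opp y)) |].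
  apply Req_le. f_equal. exact (norm_opp (V := H) y).
Qed.

Lemma norm_minus_sym x y : norm (minus x y) = norm (minus y x).
Proof.
  transitivity (norm (opp (minus y x))).
  - f_equal. symmetry. exact (opp_minus (G := H) y x).
  - exact (norm_opp (V := H) (minus y x)).
Qed.

Lemma norm_minus_trans x y z :
  norm (minus x y) <= norm (minus x z) + norm (minus z y).
Proof.
  eapply Rle_trans; [| exact (norm_triangle (V := H) (minus x z) (minus z y))].
  apply Req_le. f_equal. exact (minus_trans (G := H) z x y).
Qed.

Lemma norm_minus_sq x y :
  norm (minus x y) ^ 2 = norm x ^ 2 - 2 * Re (inner x y) + norm y ^ 2.
Proof.
  unfold minus. rewrite norm_plus_sq.
  replace (norm (opp y)) with (norm y) by (symmetry; exact (norm_opp y)).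
  rewrite (inner_conj (opp y) x), inner_opp, Re_Cconj, (inner_conj x y).
  unfold Re, Copp, Cconj; simpl. ring.
Qed.

Lemma norm_0_eq x : norm x = 0 -> x = zero.
Proof. exact (norm_eq_zero x). Qed.

Lemma cauchy_schwarz x y : Cmod (inner x y) <= norm x * norm y.
Proof.
  set (c := inner x y).
  assert (Nx := norm_ge_0 x). assert (Ny := norm_ge_0 y).
  assert (Nc := Cmod_ge_0 c).
  destruct (Req_dec (norm y) 0) as [Hy | Hy].
  { apply norm_0_eq in Hy. unfold c. rewrite Hy, inner_zero_r, Cmod_0.
    apply Rmult_le_pos; [| rewrite <- Hy]; assumption. }
  (* Expand [0 <= | |y|^2 x - c y |^2]. *)
  assert (Hpos : 0 <= norm (minus (scal (RtoC (norm y ^ 2) : C_AbsRing) x)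
                              (scal (c : C_AbsRing) y)) ^ 2) by apply pow2_ge_0.
  rewrite norm_minus_sq, !norm_scal_C, inner_scal, inner_scal_r in Hpos.
  fold c in Hpos.
  assert (Hc : Re (Cmult (RtoC (norm y ^ 2)) (Cmult (Cconj c) c))
               = norm y ^ 2 * Cmod c ^ 2).
  { rewrite (Cmult_comm (Cconj c)), <- Cmod2_conj.
    rewrite <- RtoC_mult. reflexivity. }
  rewrite Hc, Cmod_R, Rabs_pos_eq in Hpos by apply pow2_ge_0.
  assert (Hle : 0 <= norm y ^ 2 * ((norm x * norm y) ^ 2 - Cmod c ^ 2))
    by (eapply Rle_trans; [exact Hpos | apply Req_le; ring]).
  assert (0 < norm y ^ 2) by (apply pow_lt; lra).
  apply Rnot_lt_le. intros Hlt.
  assert (0 <= norm x * norm y) by (apply Rmult_le_pos; assumption).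
  assert (norm y ^ 2 * ((norm x * norm y) ^ 2 - Cmod c ^ 2) < 0).
  { apply Rmult_pos_neg; [assumption |]. nra. }
  lra.
Qed.

(** * Completeness, Riesz representation and density *)

(** Completeness speaks of balls of the uniform structure, which match norm balls only up to
    [norm_factor]. *)
Lemma cauchy_norm_cv (u : nat -> H) :
  (forall e, 0 < e -> exists N, forall n k, (N <= n)%nat -> (N <= k)%nat ->
    norm (minus (u n) (u k)) < e) ->
  exists p, forall e, 0 < e -> exists N, forall n, (N <= n)%nat ->
    norm (minus (u n) p) < e.
Proof.
  intros Hc.
  assert (Hcv : exists p, filterlim u eventually (locally p)).
  { apply (filterlim_locally_cauchy (U := H) (F := eventually) u).
    intros eps. destruct (Hc eps (cond_pos eps)) as [N HN].
    exists (fun n => (N <= n)%nat). split; [now exists N |].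
    intros n k Hn Hk. apply (norm_compat1 (V := H) (u n) (u k)).
    now apply HN. }
  destruct Hcv as [p Hp]. exists p. intros e He.
  assert (Hf : 0 < e / @norm_factor _ H)
    by (apply Rdiv_lt_0_compat; [exact He | apply norm_factor_gt_0]).
  destruct (proj1 (filterlim_locally u p) Hp (mkposreal _ Hf)) as [N HN].
  exists N. intros n Hn. specialize (HN n Hn).
  apply (norm_compat2 (V := H) p (u n)) in HN. simpl in HN.
  replace (norm_factor * (e / norm_factor)) with e in HN; [exact HN |].
  field. apply Rgt_not_eq, norm_factor_gt_0.
Qed.

(* Both the projection onto [M] ([l = inner _ x]) and the Riesz
   representation theorem ([M = H]) are instances. *)
Lemma riesz_on_manifold (M : H -> Prop) (l : H -> C) (K : R) :
  linear_manifold M ->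
  (forall x y, l (plus x y) = Cplus (l x) (l y)) ->
  (forall (a : C) x, l (scal (a : C_AbsRing) x) = Cmult a (l x)) ->
  (forall x, Cmod (l x) <= K * norm x) ->
  exists p : H,
    (forall eps : posreal, exists m, M m /\ norm (minus p m) < eps) /\
    forall m, M m -> l m = inner m p.
Proof.
  intros [M0 [Mp Ms]] lp ls lb.
  (* If l = (., p), then q x = |x - p|^2 - |p|^2, so minimizing [q] over M means approximating p
     from M. Below, [- d] is the infimum of [q] on M. *)
  set (q := fun x : H => norm x ^ 2 - 2 * Re (l x)).
  assert (q_plus : forall x w,
    q (plus x w) = q x + 2 * (Re (inner x w) - Re (l w)) + norm w ^ 2).
  { intros x w. unfold q. rewrite norm_plus_sq, lp, Re_plus. ring. }
  assert (q_low : forall x, - K ^ 2 <= q x).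
  { intros x. unfold q. assert (h1 := Re_le_Cmod (l x)). assert (h2 := lb x).
    assert (0 <= (norm x - K) ^ 2) by apply pow2_ge_0. nra. }
  destruct (completeness (fun r => exists m, M m /\ r = - q m)) as [d [ub lub]].
  { exists (K ^ 2). intros r [m [_ ->]]. specialize (q_low m). lra. }
  { exists (- q zero). now exists zero. }
  assert (q_inf : forall m, M m -> - d <= q m).
  { intros m Mm. assert (- q m <= d) by (apply ub; now exists m). lra. }
  assert (q_min : forall n : nat, exists m, M m /\ q m < - d + / INR (S n)).
  { intros n. apply NNPP. intros Hn.
    assert (Hi : 0 < / INR (S n)) by (apply Rinv_0_lt_compat, lt_0_INR; lia).
    assert (d <= d - / INR (S n)); [| lra].
    apply lub. intros r [m [Mm ->]].
    apply Rnot_lt_le. intros Hlt. apply Hn. exists m. split; [easy | lra]. }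
  destruct (choice _ q_min) as [u Hu].
  (* parallelogram identity *)
  assert (close : forall n k, norm (minus (u n) (u k)) ^ 2 <=
                              2 * (/ INR (S n) + / INR (S k))).
  { intros n k. destruct (Hu n) as [Mn qn]. destruct (Hu k) as [Mk qk].
    assert (Hmid := q_inf _ (Ms (RtoC (/ 2)) _ (Mp _ _ Mn Mk))).
    unfold q in Hmid, qn, qk. rewrite norm_scal_C in Hmid.
    rewrite ls, lp, Cmod_R, Rabs_pos_eq, Rpow_mult_distr, norm_plus_sq in Hmid
      by lra.
    replace (Re (Cmult (RtoC (/ 2)) (Cplus (l (u n)) (l (u k)))))
      with (/ 2 * (Re (l (u n)) + Re (l (u k)))) in Hmid
      by (unfold Re, Cmult, Cplus; simpl; ring).
    rewrite norm_minus_sq. lra. }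
  destruct (cauchy_norm_cv u) as [p Hp].
  { intros e He0.
    assert (He : 0 < e ^ 2 / 4) by (apply Rdiv_lt_0_compat; [now apply pow_lt | lra]).
    destruct (archimed_cor1 _ He) as [N [HN HN0]].
    exists N. intros n k Hn Hk.
    apply Rnot_le_lt. intros Hlt.
    assert (H0 : forall n, (N <= n)%nat -> / INR (S n) <= / INR N).
    { intros n' Hn'. apply Rinv_le_contravar; [now apply lt_0_INR |].
      apply le_INR; lia. }
    assert (h1 := close n k). assert (h2 := H0 n Hn). assert (h3 := H0 k Hk).
    assert (e ^ 2 <= norm (minus (u n) (u k)) ^ 2) by (apply pow_incr; lra).
    lra. }
  (* This is q(p + w) >= q(p), obtained as the limit of q(u_n + w) - q(u_n) > -1/(n+1). If the right
     side [r] were negative, the two errors, from 1/(n+1) and from (u_n - p, w), could each be kept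
     below -r/2. *)
  assert (stat : forall w, M w ->
    0 <= 2 * (Re (inner p w) - Re (l w)) + norm w ^ 2).
  { intros w Mw. apply Rnot_lt_le. intros Hneg.
    set (r := 2 * (Re (inner p w) - Re (l w)) + norm w ^ 2) in *.
    assert (Nw := norm_ge_0 w).
    assert (He : 0 < - r / (2 * (2 * norm w + 1)))
      by (apply Rdiv_lt_0_compat; lra).
    destruct (Hp _ He) as [N1 HN1].
    assert (He2 : 0 < - r / 2) by lra.
    destruct (archimed_cor1 _ He2) as [N2 [HN2 HN20]].
    set (n := (N1 + N2)%nat).
    specialize (HN1 n ltac:(unfold n; lia)).
    destruct (Hu n) as [Mn qn].
    assert (Hi : / INR (S n) <= / INR N2).
    { apply Rinv_le_contravar; [now apply lt_0_INR | apply le_INR; unfold n; lia]. }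
    assert (h := q_inf _ (Mp _ _ Mn Mw)). rewrite q_plus in h.
    assert (hc := Re_le_Cmod (inner (minus (u n) p) w)).
    assert (hcs := cauchy_schwarz (minus (u n) p) w).
    rewrite inner_minus in hc, hcs.
    change (Re (Cminus (inner (u n) w) (inner p w)))
      with (Re (inner (u n) w) - Re (inner p w)) in hc.
    assert (norm (minus (u n) p) * (2 * norm w + 1) < - r / 2).
    { apply Rmult_lt_compat_r with (r := 2 * norm w + 1) in HN1; [| lra].
      replace (- r / (2 * (2 * norm w + 1)) * (2 * norm w + 1)) with (- r / 2)
        in HN1 by (field; lra). exact HN1. }
    assert (0 <= norm (minus (u n) p)) by apply norm_ge_0.
    unfold r in *. nra. }
  exists p. split.
  { intros eps. destruct (Hp eps (cond_pos eps)) as [N HN].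
    exists (u N). split; [apply Hu |].
    rewrite <- norm_opp, opp_minus. apply HN, le_n. }
  intros m Mm.
  (* Test stationarity with w = -s conj(c) m. The conjugate removes the phase of c, and s = 1/(1 +
     |m|^2) keeps the quadratic term below the linear one, so the inequality fails unless c = 0. *)
  set (c := Cminus (inner m p) (l m)).
  set (s := / (1 + norm m ^ 2)).
  assert (Nm : 0 <= norm m ^ 2) by apply pow2_ge_0.
  assert (Hs : 0 < s) by (apply Rinv_0_lt_compat; lra).
  set (a := Cmult (RtoC (- s)) (Cconj c)).
  set (w := scal (a : C_AbsRing) m).
  assert (h := stat w (Ms a m Mm)).
  rewrite (inner_conj w p), Re_Cconj in h. unfold w in h.
  rewrite inner_scal, ls in h. rewrite norm_scal_C in h.
  assert (E : Re (Cmult a (inner m p)) - Re (Cmult a (l m)) = - s * Cmod c ^ 2).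
  { transitivity (Re (Cmult (RtoC (- s)) (Cmult c (Cconj c)))).
    { change (Re (Cminus (Cmult a (inner m p)) (Cmult a (l m)))
        = Re (Cmult (RtoC (- s)) (Cmult c (Cconj c)))).
      f_equal. unfold a, c. ring. }
    rewrite <- Cmod2_conj, <- RtoC_mult. reflexivity. }
  rewrite E in h.
  assert (Ea : Cmod a = s * Cmod c).
  { unfold a. rewrite Cmod_mult, Cmod_R, Rabs_left, Cmod_conj by lra. ring. }
  rewrite Ea in h.
  assert (Hc0 : Cmod c ^ 2 = 0).
  { assert (Nc : 0 <= Cmod c ^ 2) by apply pow2_ge_0.
    assert (Es : s * (1 + norm m ^ 2) = 1) by (unfold s; field; lra).
    replace (2 * (- s * Cmod c ^ 2) + (s * Cmod c * norm m) ^ 2)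
      with (s * Cmod c ^ 2 * (s * (1 + norm m ^ 2) - s - 2)) in h by ring.
    rewrite Es in h.
    destruct (Rle_lt_or_eq_dec _ _ Nc) as [Hlt | Heq]; [| easy].
    assert (0 < s * Cmod c ^ 2) by now apply Rmult_lt_0_compat.
    nra. }
  assert (H0 : c = RtoC 0).
  { apply Cmod_eq_0. destruct (Rmult_integral _ _ Hc0) as [|h0]; [easy |].
    rewrite Rmult_1_r in h0. exact h0. }
  unfold c in H0.
  replace (l m) with (Cminus (inner m p) (Cminus (inner m p) (l m))) by ring.
  rewrite H0. ring.
Qed.

(** The vector p representing (., x) on M is the projection of x onto the closure of M; x - p is
    orthogonal to M, hence zero. *)
Lemma dense_of_orthogonal (M : H -> Prop) :
  linear_manifold M ->
  (forall v, (forall m, M m -> inner m v = 0) -> v = zero) ->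
  dense_set M.
Proof.
  intros HM Hort x.
  destruct (riesz_on_manifold M (fun y => inner y x) (norm x)) as [p [Hp Ho]].
  - exact HM.
  - intros; apply inner_plus.
  - intros; apply inner_scal.
  - intros y. rewrite Rmult_comm. apply cauchy_schwarz.
  - assert (E : minus x p = zero).
    { apply Hort. intros m Mm. rewrite inner_minus_r, <- Ho by exact Mm. ring. }
    intros eps. destruct (Hp eps) as [m [Mm Hm]]. exists m. split; [easy |].
    replace x with p; [exact Hm |].
    apply (plus_reg_r (G := H) (opp p)). symmetry.
    rewrite (plus_opp_r (G := H) p). exact E.
Qed.

Lemma exists_adjoint (A : H -> H) : is_linear A ->
  forall h, exists w, forall k, inner (A k) h = inner k w.
Proof.
  intros [Ap As [K [HK Ab]]] h.
  destruct (riesz_on_manifold (fun _ => True) (fun k => inner (A k) h)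
              (K * norm h)) as [w [_ Hw]].
  - repeat split.
  - intros x y. now rewrite Ap, inner_plus.
  - intros a x. now rewrite As, inner_scal.
  - intros x. apply Rle_trans with (1 := cauchy_schwarz _ _).
    specialize (Ab x). assert (0 <= norm h) by apply norm_ge_0. nra.
  - exists w. intros k. now apply Hw.
Qed.

Lemma bounded_linear_minus (A : H -> H) x y : is_linear A ->
  A (minus x y) = minus (A x) (A y).
Proof.
  intros HA. unfold minus. rewrite (linear_plus A HA). f_equal.
  exact (linear_opp A y HA).
Qed.

Lemma minus_zero_eq x y : norm (minus x y) = 0 -> x = y.
Proof.
  intros h. apply norm_0_eq in h. apply (plus_reg_r (G := H) (opp y)).
  rewrite (plus_opp_r (G := H) y). exact h.
Qed.

Lemma eq_of_norm_small x y (c : R) :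
  (forall e, 0 < e -> norm (minus x y) <= c * e) -> x = y.
Proof.
  intros h. apply minus_zero_eq. apply Rle_antisym; [| apply norm_ge_0].
  apply Rnot_lt_le. intros Hlt.
  assert (Hc := Rabs_pos c). assert (Hc' := Rle_abs c).
  set (e := norm (minus x y) / (Rabs c + 1)).
  assert (He : 0 < e) by (apply Rdiv_lt_0_compat; lra).
  specialize (h e He).
  assert (norm (minus x y) = e * (Rabs c + 1)) by (unfold e; field; lra).
  nra.
Qed.

(* Lax-Milgram *)
Lemma coercive_surjective (G : H -> H) (gamma : R) :
  is_linear G -> 0 < gamma ->
  (forall x, gamma * norm x ^ 2 <= Re (inner (G x) x)) ->
  (forall x, gamma * norm x <= norm (G x)) /\ forall w, exists u, G u = w.
Proof.
  intros HG Hg Hco.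
  assert (low : forall x, gamma * norm x <= norm (G x)).
  { intros x. assert (h1 := Hco x). assert (h2 := Re_le_Cmod (inner (G x) x)).
    assert (h3 := cauchy_schwarz (G x) x).
    assert (h4 := norm_ge_0 x). assert (h5 := norm_ge_0 (G x)).
    destruct h4 as [h4 | h4]; [| rewrite <- h4, Rmult_0_r; exact h5].
    apply Rmult_le_reg_r with (norm x); [exact h4 |]. lra. }
  split; [exact low |]. intros w.
  (* A vector v orthogonal to the range satisfies (G v, v) = 0, and coercivity forces v = 0. *)
  assert (Hd : dense_set (fun y => exists x, y = G x)).
  { apply dense_of_orthogonal.
    - split; [| split].
      + exists zero. symmetry. exact (linear_zero G HG).
      + intros x y [x' ->] [y' ->]. exists (plus x' y').
        symmetry. apply (linear_plus G HG).
      + intros a x [x' ->]. exists (scal a x').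
        symmetry. exact (linear_scal G HG a x').
    - intros v Hv. apply norm_0_eq.
      assert (h := Hco v). rewrite (Hv (G v)) in h by now exists v.
      change (Re 0) with 0 in h.
      assert (h1 : 0 <= norm v) by apply norm_ge_0.
      apply Rle_antisym; [| exact h1]. apply Rnot_lt_le. intros Hlt.
      assert (0 < gamma * norm v ^ 2)
        by (apply Rmult_lt_0_compat; [exact Hg | now apply pow_lt]).
      lra. }
  assert (Hn : forall n : nat, exists u, norm (minus w (G u)) < / INR (S n)).
  { intros n. assert (Hi : 0 < / INR (S n)) by (apply Rinv_0_lt_compat, lt_0_INR; lia).
    destruct (Hd w (mkposreal _ Hi)) as [y [[u ->] Hu]]. now exists u. }
  destruct (choice _ Hn) as [u Hu].
  assert (Hsmall : forall e, 0 < e -> exists N, forall n, (N <= n)%nat ->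
    norm (minus w (G (u n))) < e).
  { intros e He. destruct (archimed_cor1 _ He) as [N [HN HN0]].
    exists N. intros n Hn'. apply Rlt_trans with (1 := Hu n).
    apply Rle_lt_trans with (2 := HN).
    apply Rinv_le_contravar; [now apply lt_0_INR | apply le_INR; lia]. }
  assert (diff : forall x y, norm (minus (G x) (G y)) <=
    norm (minus w (G x)) + norm (minus w (G y))).
  { intros x y. rewrite (norm_minus_sym w (G x)). apply norm_minus_trans. }
  (* The range is closed: by [low], convergence of G u_n makes u_n a Cauchy sequence. *)
  destruct (cauchy_norm_cv u) as [p Hp].
  { intros e He. assert (He' : 0 < gamma * e / 2) by nra.
    destruct (Hsmall _ He') as [N HN]. exists N. intros n k Hn' Hk'.
    assert (h1 := HN n Hn'). assert (h2 := HN k Hk').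
    assert (h3 := diff (u n) (u k)). rewrite <- bounded_linear_minus in h3 by easy.
    assert (h4 := low (minus (u n) (u k))). nra. }
  exists p. destruct (linear_norm G HG) as [K [HK Kb]].
  symmetry. apply eq_of_norm_small with (K + 1). intros e He.
  destruct (Hsmall e He) as [N1 HN1]. destruct (Hp e He) as [N2 HN2].
  set (n := (N1 + N2)%nat).
  specialize (HN1 n ltac:(unfold n; lia)). specialize (HN2 n ltac:(unfold n; lia)).
  assert (h1 := Kb (minus (u n) p)).
  change (norm (G (minus (u n) p)) <= K * norm (minus (u n) p)) in h1.
  rewrite bounded_linear_minus in h1 by easy.
  assert (h2 := norm_minus_trans w (G p) (G (u n))).
  nra.
Qed.

End InnerProduct.

(** * Improper integrals *)

Section Dominated.

Context {V : CompleteNormedModule R_AbsRing}.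

(** Cauchy criterion along the filter of endpoints: moving one endpoint changes the integral of f by
    at most the integral of g over the piece gained or lost. *)
Lemma is_RInt_gen_dominated (Fa Fb : (R -> Prop) -> Prop)
    {FFa : ProperFilter Fa} {FFb : ProperFilter Fb}
    (f : R -> V) (g : R -> R) (lg : R) :
  filter_prod Fa Fb (fun ab => fst ab <= snd ab /\
    ex_RInt f (fst ab) (snd ab) /\
    forall x, fst ab <= x <= snd ab -> norm (f x) <= g x) ->
  is_RInt_gen g Fa Fb lg ->
  exists l, is_RInt_gen f Fa Fb l /\ norm l <= lg.
Proof.
  intros Hdom Hg.
  assert (Hex : exists l, is_RInt_gen f Fa Fb l).
  { destruct Hdom as [Q0 P0 HQ0 HP0 Hdom].
    assert (cauchy : exists l, filterlim (fun ab => RInt f (fst ab) (snd ab))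
                            (filter_prod Fa Fb) (locally l)).
    { apply filterlim_locally_cauchy.
      intros eps.
      assert (He : 0 < eps / 4) by (apply Rdiv_lt_0_compat; [apply eps | lra]).
      assert (Hloc : locally lg (ball lg (mkposreal _ He))) by apply locally_ball.
      destruct (Hg _ Hloc) as [Q1 P1 HQ1 HP1 Hg1]. simpl in Hg1.
      exists (fun ab => (Q0 (fst ab) /\ Q1 (fst ab)) /\ (P0 (snd ab) /\ P1 (snd ab))).
      split.
      { exists (fun a => Q0 a /\ Q1 a) (fun b => P0 b /\ P1 b);
          [now apply filter_and | now apply filter_and | now intros]. }
      (* Two integrals of g within eps/4 of [lg] differ by less than eps/2; this bounds one end
         piece, and there are two ends. *)
      assert (near : forall a b, Q1 a -> P1 b ->
        exists y, is_RInt g a b y /\ Rabs (y - lg) < eps / 4).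
      { intros a b Qa Pb. destruct (Hg1 a b Qa Pb) as [y [Hy1 Hy2]].
        now exists y. }
      assert (left_le : forall a a' b, Q0 a -> Q1 a -> Q0 a' -> Q1 a' -> P0 b ->
        P1 b -> a <= a' ->
        norm (minus (RInt f a b) (RInt f a' b)) < eps / 2).
      { intros a a' b Qa Qa1 Qa' Qa1' Pb Pb1 Haa.
        destruct (near a b Qa1 Pb1) as [y [Hy1 Hy2]].
        destruct (near a' b Qa1' Pb1) as [y' [Hy1' Hy2']].
        destruct (Hdom a b Qa Pb) as [Hab [Hf Hle]].
        destruct (Hdom a' b Qa' Pb) as [Hab' [Hf' _]]. simpl in *.
        assert (Hfa : is_RInt f a a' (minus (RInt f a b) (RInt f a' b))).
        { apply (is_RInt_Chasles (V := V) f a b a').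
          - now apply RInt_correct.
          - apply (is_RInt_swap (V := V)). now apply RInt_correct. }
        assert (Hga : is_RInt g a a' (minus y y')).
        { apply (is_RInt_Chasles (V := R_NormedModule) g a b a'); [easy |].
          now apply (is_RInt_swap (V := R_NormedModule)). }
        apply Rle_lt_trans with (minus y y').
        - apply (norm_RInt_le f g a a' _ _ Haa); [| easy | easy].
          intros x Hx. apply Hle. lra.
        - change (y - y' < eps / 2).
          apply Rabs_def2 in Hy2. apply Rabs_def2 in Hy2'. lra. }
      assert (right_le : forall a b b', Q0 a -> Q1 a -> P0 b -> P1 b -> P0 b' ->
        P1 b' -> b <= b' ->
        norm (minus (RInt f a b') (RInt f a b)) < eps / 2).
      { intros a b b' Qa Qa1 Pb Pb1 Pb' Pb1' Hbb.
        destruct (near a b Qa1 Pb1) as [y [Hy1 Hy2]].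
        destruct (near a b' Qa1 Pb1') as [y' [Hy1' Hy2']].
        destruct (Hdom a b Qa Pb) as [Hab [Hf _]].
        destruct (Hdom a b' Qa Pb') as [Hab' [Hf' Hle]]. simpl in *.
        assert (Hfa : is_RInt f b b' (minus (RInt f a b') (RInt f a b))).
        { unfold minus. rewrite plus_comm.
          apply (is_RInt_Chasles (V := V) f b a b').
          - apply (is_RInt_swap (V := V)). now apply RInt_correct.
          - now apply RInt_correct. }
        assert (Hga : is_RInt g b b' (minus y' y)).
        { unfold minus. rewrite plus_comm.
          apply (is_RInt_Chasles (V := R_NormedModule) g b a b'); [| easy].
          now apply (is_RInt_swap (V := R_NormedModule)). }
        apply Rle_lt_trans with (minus y' y).
        - apply (norm_RInt_le f g b b' _ _ Hbb); [| easy | easy].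
          intros x Hx. apply Hle. lra.
        - change (y' - y < eps / 2).
          apply Rabs_def2 in Hy2. apply Rabs_def2 in Hy2'. lra. }
      intros [a b] [a' b'] [[Qa Qa1] [Pb Pb1]] [[Qa' Qa1'] [Pb' Pb1']].
      simpl in *. apply (norm_compat1 (V := V) (RInt f a b) (RInt f a' b')).
      assert (E : minus (RInt f a' b') (RInt f a b) =
        plus (minus (RInt f a' b') (RInt f a' b))
             (minus (RInt f a' b) (RInt f a b))).
      { unfold minus. rewrite plus_assoc. f_equal. rewrite <- plus_assoc.
        now rewrite plus_opp_l, plus_zero_r. }
      apply Rle_lt_trans with (norm (minus (RInt f a' b') (RInt f a' b)) +
                               norm (minus (RInt f a' b) (RInt f a b))).
      { eapply Rle_trans; [| apply (norm_triangle (V := V))].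
        apply Req_le. exact (f_equal (norm (V := V)) E). }
      replace (pos eps) with (eps / 2 + eps / 2) by field.
      apply Rplus_lt_compat.
      - destruct (Rle_dec b b').
        + now apply right_le.
        + rewrite <- norm_opp, opp_minus. apply right_le; try easy. lra.
      - destruct (Rle_dec a' a).
        + now apply left_le.
        + rewrite <- norm_opp, opp_minus. apply left_le; try easy. lra. }
    destruct cauchy as [l Hl]. exists l.
    apply (filterlimi_lim_ext_loc (fun ab => RInt f (fst ab) (snd ab))); [| easy].
    exists Q0 P0; try easy. intros a b Qa Pb. simpl.
    apply RInt_correct. now apply (Hdom a b). }
  destruct Hex as [l Hl]. exists l. split; [easy |].
  apply (RInt_gen_norm (Fa := Fa) (Fb := Fb) f g l lg); [| | easy | easy].
  - revert Hdom. apply filter_imp. tauto.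
  - revert Hdom. apply filter_imp. tauto.
Qed.

Lemma is_RInt_gen_primitive (Fa Fb : (R -> Prop) -> Prop)
    {FFa : Filter Fa} {FFb : Filter Fb} (P g : R -> R) (la lb : R) :
  filter_prod Fa Fb (fun ab => is_RInt g (fst ab) (snd ab)
                                 (P (snd ab) - P (fst ab))) ->
  filterlim P Fa (locally la) -> filterlim P Fb (locally lb) ->
  is_RInt_gen g Fa Fb (lb - la).
Proof.
  intros HP Ha Hb.
  apply (filterlimi_lim_ext_loc (fun ab => P (snd ab) - P (fst ab))); [easy |].
  apply (filterlim_comp_2 (G := locally lb) (H := locally (- la))
           (fun ab : R * R => P (snd ab)) (fun ab => - P (fst ab)) Rplus).
  - apply (filterlim_comp _ _ _ snd P _ Fb); [apply filterlim_snd | easy].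
  - apply (filterlim_comp _ _ _ (fun ab : R * R => P (fst ab)) Ropp
             _ (locally la)).
    + apply (filterlim_comp _ _ _ fst P _ Fa); [apply filterlim_fst | easy].
    + exact (filterlim_opp (V := R_NormedModule) la).
  - exact (filterlim_plus (V := R_NormedModule) lb (- la)).
Qed.

Lemma is_derive_Rpower (p x : R) : 0 < x ->
  is_derive (fun t => Rpower t p) x (p * Rpower x (p - 1)).
Proof. intros Hx. apply is_derive_Reals. now apply derivable_pt_lim_power. Qed.

Lemma continuous_Rpower (p x : R) : 0 < x -> continuous (fun t => Rpower t p) x.
Proof.
  intros Hx. apply (ex_derive_continuous (V := R_NormedModule)).
  eexists. now apply is_derive_Rpower.
Qed.

Lemma is_RInt_Rpower (p K a b : R) : p <> 0 -> 0 < a -> 0 < b ->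
  is_RInt (fun t => K * Rpower t (p - 1)) a b
    (K / p * Rpower b p - K / p * Rpower a p).
Proof.
  intros Hp Ha Hb.
  apply (is_RInt_derive (V := R_CompleteNormedModule)
           (fun t => K / p * Rpower t p)).
  - intros x [Hx _].
    assert (0 < x)
      by (apply Rlt_le_trans with (2 := Hx); now apply Rmin_glb_lt).
    replace (K * Rpower x (p - 1)) with (K / p * (p * Rpower x (p - 1)))
      by (field; easy).
    apply (is_derive_scal (fun t => Rpower t p) x (K / p)).
    now apply is_derive_Rpower.
  - intros x [Hx _].
    assert (0 < x)
      by (apply Rlt_le_trans with (2 := Hx); now apply Rmin_glb_lt).
    apply (continuous_scal_r (V := R_NormedModule) K
             (fun t => Rpower t (p - 1))).
    now apply continuous_Rpower.
Qed.

Lemma filterlim_Rpower_right_0 (p : R) : 0 < p ->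
  filterlim (fun t => Rpower t p) (at_right 0) (locally 0).
Proof.
  intros Hp. apply filterlim_locally. intros eps.
  exists (mkposreal _ (exp_pos (/ p * ln eps))).
  intros t Ht Ht0. change (Rabs (t - 0) < Rpower eps (/ p)) in Ht.
  change (Rabs (Rpower t p - 0) < eps).
  rewrite Rminus_0_r, Rabs_pos_eq in * by (try apply Rlt_le, exp_pos; lra).
  apply Rlt_le_trans with (Rpower (Rpower eps (/ p)) p).
  - now apply Rlt_Rpower_l.
  - rewrite Rpower_mult, Rinv_l, Rpower_1 by (try apply eps; lra). lra.
Qed.

Lemma filterlim_Rpower_p_infty (p : R) : p < 0 ->
  filterlim (fun t => Rpower t p) (Rbar_locally p_infty) (locally 0).
Proof.
  intros Hp. apply filterlim_locally. intros eps.
  exists (Rpower eps (/ p)). intros t Ht.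
  assert (Ht0 : 0 < t)
    by (apply Rlt_trans with (2 := Ht); apply exp_pos).
  change (Rabs (Rpower t p - 0) < eps).
  rewrite Rminus_0_r, Rabs_pos_eq by apply Rlt_le, exp_pos.
  assert (E : Rpower (Rpower eps (/ p)) p = eps)
    by (rewrite Rpower_mult, Rinv_l, Rpower_1 by (try apply eps; lra); easy).
  rewrite <- E. unfold Rpower at 1 2. apply exp_increasing.
  apply Rmult_lt_gt_compat_neg_l; [easy |].
  apply ln_increasing; [apply exp_pos | easy].
Qed.

(** [K0 / a] is the integral of K0 l^(a-1) over (0,1), and [K1 / (1 - a)] that of K1 l^(a-2) over
    (1,oo). *)
Lemma is_RInt_gen_Rpower_scal (phi : R -> V) (a K0 K1 : R) :
  0 < a < 1 ->
  (forall l, 0 < l -> continuous phi l) ->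
  (forall l, 0 < l -> norm (phi l) <= K0) ->
  (forall l, 0 < l -> norm (phi l) <= K1 / l) ->
  exists v, is_RInt_gen (fun l => scal (Rpower l (a - 1)) (phi l))
              (at_right 0) (Rbar_locally p_infty) v /\
            norm v <= K0 / a + K1 / (1 - a).
Proof.
  intros Ha Hc H0 H1.
  assert (Hint : forall x y, 0 < x -> 0 < y ->
    ex_RInt (fun l => scal (Rpower l (a - 1)) (phi l)) x y).
  { intros x y Hx Hy. apply ex_RInt_continuous. intros z [Hz _].
    assert (0 < z) by (apply Rlt_le_trans with (2 := Hz); now apply Rmin_glb_lt).
    apply (continuous_scal (fun l => Rpower l (a - 1)) phi);
      [now apply continuous_Rpower | now apply Hc]. }
  assert (Hn : forall l, norm (scal (Rpower l (a - 1)) (phi l))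
                 <= Rpower l (a - 1) * norm (phi l)).
  { intros l.
    eapply Rle_trans; [exact (norm_scal (V := V) (Rpower l (a - 1)) (phi l)) |].
    apply Rmult_le_compat_r; [apply norm_ge_0 |].
    change (Rabs (Rpower l (a - 1)) <= Rpower l (a - 1)).
    rewrite Rabs_pos_eq; [lra | apply Rlt_le, exp_pos]. }
  assert (Hr : at_right 0 (fun x => 0 < x <= 1)).
  { exists (mkposreal 1 Rlt_0_1). intros x Hx Hx0.
    change (Rabs (x - 0) < 1) in Hx. apply Rabs_def2 in Hx. lra. }
  destruct (is_RInt_gen_dominated (at_right 0) (at_point 1)
    (fun l => scal (Rpower l (a - 1)) (phi l))
    (fun l => K0 * Rpower l (a - 1)) (K0 / a * Rpower 1 a - K0 / a * 0))
    as [v0 [Hv0 Nv0]].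
  { exists (fun x => 0 < x <= 1) (fun y => y = 1); [easy | easy |].
    intros x y Hx ->. simpl. split; [lra | split; [apply Hint; lra |]].
    intros z Hz. eapply Rle_trans; [apply Hn |]. rewrite Rmult_comm.
    apply Rmult_le_compat_r; [apply Rlt_le, exp_pos | apply H0; lra]. }
  { apply (is_RInt_gen_primitive _ _ (fun t => K0 / a * Rpower t a)).
    - exists (fun x => 0 < x <= 1) (fun y => y = 1); [easy | easy |].
      intros x y Hx ->. apply is_RInt_Rpower; simpl; lra.
    - apply (filterlim_comp _ _ _ (fun t => Rpower t a) (Rmult (K0 / a))
               _ (locally 0)).
      + apply filterlim_Rpower_right_0; lra.
      + exact (filterlim_scal_r (V := R_NormedModule) (K0 / a) 0).
    - intros Q HQ. exact (locally_singleton _ _ HQ). }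
  (* The exponent is written a - 1 - 1 to match [is_RInt_Rpower] at p = a - 1 < 0, whose primitive
     vanishes at infinity. The endpoint [at_point 1] allows gluing by Chasles. *)
  destruct (is_RInt_gen_dominated (at_point 1) (Rbar_locally p_infty)
    (fun l => scal (Rpower l (a - 1)) (phi l))
    (fun l => K1 * Rpower l (a - 1 - 1))
    (K1 / (a - 1) * 0 - K1 / (a - 1) * Rpower 1 (a - 1)))
    as [v1 [Hv1 Nv1]].
  { exists (fun y => y = 1) (fun x => 1 < x); [easy | now exists 1 |].
    intros y x -> Hx. simpl. split; [lra | split; [apply Hint; lra |]].
    intros z Hz. eapply Rle_trans; [apply Hn |].
    apply Rle_trans with (Rpower z (a - 1) * (K1 / z)).
    - apply Rmult_le_compat_l; [apply Rlt_le, exp_pos | apply H1; lra].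
    - replace (a - 1 - 1) with (a - 1 + - (1)) by ring.
      rewrite Rpower_plus, Rpower_Ropp, Rpower_1 by lra.
      apply Req_le. field. simpl in Hz. lra. }
  { apply (is_RInt_gen_primitive _ _ (fun t => K1 / (a - 1) * Rpower t (a - 1))).
    - exists (fun y => y = 1) (fun x => 1 < x); [easy | now exists 1 |].
      intros y x -> Hx. apply is_RInt_Rpower; simpl; lra.
    - intros Q HQ. exact (locally_singleton _ _ HQ).
    - apply (filterlim_comp _ _ _ (fun t => Rpower t (a - 1))
               (Rmult (K1 / (a - 1))) _ (locally 0)).
      + apply filterlim_Rpower_p_infty; lra.
      + exact (filterlim_scal_r (V := R_NormedModule) (K1 / (a - 1)) 0). }
  exists (plus v0 v1). split.
  { now apply is_RInt_gen_Chasles with 1. }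
  eapply Rle_trans; [apply norm_triangle |].
  assert (R1 : forall p, Rpower 1 p = 1)
    by (intros p; unfold Rpower; rewrite ln_1, Rmult_0_r; apply exp_0).
  rewrite R1 in Nv0, Nv1.
  replace (K0 / a + K1 / (1 - a)) with
    ((K0 / a * 1 - K0 / a * 0) + (K1 / (a - 1) * 0 - K1 / (a - 1) * 1))
    by (field; lra).
  now apply Rplus_le_compat.
Qed.

End Dominated.

(** * Bounded linear maps: passage under the integral, operator norm *)

Lemma plus_minus_r {G : AbelianGroup} (x y : G) : minus (plus x y) y = x.
Proof.
  transitivity (plus x (plus y (opp y))); [symmetry; apply plus_assoc |].
  rewrite (plus_opp_r y). apply plus_zero_r.
Qed.

Lemma plus_minus_l {G : AbelianGroup} (x y : G) : minus (plus x y) x = y.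
Proof. rewrite plus_comm. apply plus_minus_r. Qed.

Lemma Riemann_sum_linear {U V : NormedModule R_AbsRing} (A : U -> V)
    (f : R -> U) (ptd : SF_seq) :
  is_linear A -> A (Riemann_sum f ptd) = Riemann_sum (fun t => A (f t)) ptd.
Proof.
  intros HA. induction ptd as [h | h ptd IH] using SF_cons_ind.
  - exact (linear_zero A HA).
  - rewrite !Riemann_sum_cons, (linear_plus A HA), (linear_scal A HA), IH.
    reflexivity.
Qed.

(** Continuity of A is used twice, for the limit of Riemann sums and for the limit in the endpoints.
    This will carry J^(-1) under the Balakrishnan integral. *)
Lemma is_RInt_gen_linear {U V : NormedModule R_AbsRing} (A : U -> V)
    (f : R -> U) (Fa Fb : (R -> Prop) -> Prop) {FFa : Filter Fa} {FFb : Filter Fb}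
    (l : U) :
  is_linear A -> is_RInt_gen f Fa Fb l ->
  is_RInt_gen (fun t => A (f t)) Fa Fb (A l).
Proof.
  intros HA Hf P HP.
  assert (HP' := linear_cont A l HA P HP).
  specialize (Hf _ HP'). revert Hf. unfold filtermapi. apply filter_imp.
  intros [a b] [y [Hy HPy]]. exists (A y). split; [| easy]. simpl in *.
  apply filterlim_ext with
    (fun ptd => A (scal (sign (b - a)) (Riemann_sum f ptd))).
  - intros ptd. now rewrite (linear_scal A HA), Riemann_sum_linear.
  - apply filterlim_comp with (1 := Hy). now apply (linear_cont A).
Qed.

Section RealStructure.

Variable H : Hilbert.

(** Restriction of scalars keeps the uniform structure, so the completeness of H is reused
    unchanged. *)
Definition real_CompleteNormedModule : CompleteNormedModule R_AbsRing :=
  CompleteNormedModule.Pack R_AbsRing H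
    (CompleteNormedModule.Class R_AbsRing H
      (NormedModule.class R_AbsRing (real_NormedModule H))
      (CompleteNormedModule.mixin _ _ (CompleteNormedModule.class _ H))) H.

Lemma is_linear_real (A : H -> H) : is_linear A ->
  is_linear (A : real_NormedModule H -> real_NormedModule H).
Proof.
  intros [Ap As Ab]. split.
  - exact Ap.
  - intros k x. exact (As (RtoC k) x).
  - exact Ab.
Qed.

Variable T : operator H.
Variable A : H -> H.
Hypothesis A_lin : is_linear A.
Hypothesis TA : forall f g, T f g <-> g = A f.

(** [op_norm] takes the real part of an extended supremum, so finiteness comes first: the set
    contains 0 and is bounded by a constant of A. *)
Lemma op_norm_bound : 0 <= op_norm T /\ forall x, norm (A x) <= op_norm T * norm x.
Proof.
  destruct (linear_norm A A_lin) as [K [HK Ab]].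
  unfold op_norm.
  set (E := fun r => exists f g, T f g /\ norm f <= 1 /\ r = norm g).
  destruct (Lub_Rbar_correct E) as [ub lub].
  assert (A0 : A zero = zero) by exact (linear_zero A A_lin).
  assert (N0 : norm (zero : H) = 0) by exact (norm_zero (V := H)).
  assert (E0 : E 0).
  { exists zero, zero. split; [now apply TA |].
    rewrite N0. split; [lra | easy]. }
  assert (h0 := ub 0 E0).
  assert (hK : Rbar_le (Lub_Rbar E) K).
  { apply lub. intros r [f [g [Hfg [Hf ->]]]]. apply TA in Hfg. subst g.
    specialize (Ab f). simpl. nra. }
  destruct (Lub_Rbar E) as [N | |]; simpl in h0, hK; try easy.
  simpl. split; [easy |]. intros x.
  destruct (Req_dec (norm x) 0) as [Hx | Hx].
  { rewrite (norm_0_eq H x Hx), A0, N0. lra. }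
  assert (Nx := norm_ge_0 x).
  assert (Hi : 0 < / norm x) by (apply Rinv_0_lt_compat; lra).
  set (x' := scal (RtoC (/ norm x) : C_AbsRing) x).
  assert (EA : norm (A x') = / norm x * norm (A x)).
  { unfold x'. rewrite (linear_scal A A_lin), norm_scal_C, Cmod_R.
    rewrite Rabs_pos_eq; lra. }
  assert (hx : Rbar_le (norm (A x')) N).
  { apply ub. exists x', (A x'). split; [now apply TA |]. split; [| easy].
    unfold x'. rewrite norm_scal_C, Cmod_R, Rabs_pos_eq, Rinv_l; lra. }
  simpl in hx. rewrite EA in hx.
  apply Rmult_le_compat_l with (r := norm x) in hx; [| easy].
  rewrite <- Rmult_assoc, Rinv_r, Rmult_1_l in hx by easy. lra.
Qed.

End RealStructure.

(** * Fractional powers *)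

Section FractionalPower.

Variable H : Hilbert.
Variables (A : H -> H) (K : R) (Rs : R -> H -> H).
Hypothesis A_lin : is_linear A.
Hypothesis K_nonneg : 0 <= K.
Hypothesis A_bound : forall x, norm (A x) <= K * norm x.
Hypothesis Rs_lin : forall l, 0 < l -> is_linear (Rs l).
Hypothesis Rs_bound : forall l x, 0 < l -> norm (Rs l x) <= / l * norm x.
Hypothesis Rs_surj : forall l f, 0 < l -> exists y,
  f = plus y (scal (RtoC l : C_AbsRing) (A y)).
Hypothesis Rs_inv : forall l y, 0 < l ->
  Rs l (plus y (scal (RtoC l : C_AbsRing) (A y))) = A y.

(** Every vector is y + l A y, and its image under A has the same form with A y in place of y. *)
Lemma resolvent_comm l f : 0 < l -> Rs l (A f) = A (Rs l f).
Proof.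
  intros Hl. destruct (Rs_surj l f Hl) as [y ->].
  rewrite Rs_inv by easy.
  rewrite (linear_plus A A_lin), (linear_scal A A_lin).
  now apply Rs_inv.
Qed.

(** Origin of the factor 2: R_l = A - l R_l A, and l R_l is a contraction. Unlike 1/l, this bound
    survives as l tends to 0. *)
Lemma resolvent_bound l f : 0 < l -> norm (Rs l f) <= 2 * K * norm f.
Proof.
  intros Hl. destruct (Rs_surj l f Hl) as [y Hy].
  assert (E : Rs l f = minus (A f) (scal (RtoC l : C_AbsRing) (Rs l (A f)))).
  { rewrite resolvent_comm by easy. rewrite Hy, Rs_inv by easy.
    rewrite (linear_plus A A_lin), (linear_scal A A_lin).
    symmetry. exact (plus_minus_r (G := H) _ _). }
  rewrite E.
  eapply Rle_trans; [apply norm_minus_le |].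
  rewrite norm_scal_C, Cmod_R, Rabs_pos_eq by lra.
  assert (h := Rs_bound l (A f) Hl).
  apply Rmult_le_compat_l with (r := l) in h; [| lra].
  rewrite <- Rmult_assoc, Rinv_r, Rmult_1_l in h by lra.
  specialize (A_bound f). lra.
Qed.

(** Write f = y + m A y = (y + l A y) + (m - l) A y, where A y = R_m f, and apply R_l. *)
Lemma resolvent_identity l m f : 0 < l -> 0 < m ->
  Rs l f = plus (Rs m f) (scal (RtoC (m - l) : C_AbsRing) (Rs l (Rs m f))).
Proof.
  intros Hl Hm. destruct (Rs_surj m f Hm) as [y ->].
  rewrite (Rs_inv m) by easy.
  rewrite <- (Rs_inv l y) at 2 by easy.
  rewrite <- (linear_scal (Rs l) (Rs_lin l Hl)),
          <- (linear_plus (Rs l) (Rs_lin l Hl)).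
  f_equal. rewrite <- plus_assoc. f_equal.
  transitivity (scal (plus (RtoC l : C_AbsRing) (RtoC (m - l))) (A y)).
  - f_equal. rewrite RtoC_minus.
    change (RtoC m = Cplus (RtoC l) (Cminus (RtoC m) (RtoC l))). ring.
  - exact (scal_distr_r (RtoC l : C_AbsRing) (RtoC (m - l)) (A y)).
Qed.

Let HR := real_CompleteNormedModule H.

(** The resolvent identity and the uniform bound give a Lipschitz estimate with constant [B]. *)
Lemma resolvent_continuous u l : 0 < l ->
  continuous (fun t => Rs t u : HR) l.
Proof.
  intros Hl. set (B := 2 * K * (2 * K * norm u)).
  assert (HB : 0 <= B).
  { assert (0 <= norm u) by apply norm_ge_0.
    unfold B. repeat apply Rmult_le_pos; lra. }
  apply filterlim_locally. intros eps.
  assert (He : 0 < eps / (B + 1)) by (apply Rdiv_lt_0_compat; [apply eps | lra]).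
  (* Staying within l of l keeps t positive, where the resolvent is controlled. *)
  assert (Hd : 0 < Rmin l (eps / (B + 1))) by now apply Rmin_glb_lt.
  exists (mkposreal _ Hd). intros t Ht.
  change (Rabs (t - l) < Rmin l (eps / (B + 1))) in Ht.
  assert (Ht1 : Rabs (t - l) < l) by (eapply Rlt_le_trans; [exact Ht | apply Rmin_l]).
  assert (Ht2 : Rabs (t - l) < eps / (B + 1))
    by (eapply Rlt_le_trans; [exact Ht | apply Rmin_r]).
  assert (Ht0 : 0 < t) by (apply Rabs_def2 in Ht1; lra).
  apply (norm_compat1 (V := H) (Rs l u) (Rs t u)).
  rewrite (resolvent_identity t l u Ht0 Hl).
  assert (E : minus (plus (Rs l u) (scal (RtoC (l - t) : C_AbsRing)
     (Rs t (Rs l u)))) (Rs l u) = scal (RtoC (l - t) : C_AbsRing) (Rs t (Rs l u))).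
  { exact (plus_minus_l (G := H) _ _). }
  apply Rle_lt_trans with (norm (scal (RtoC (l - t) : C_AbsRing) (Rs t (Rs l u)))).
  { apply Req_le. exact (f_equal (norm (V := H)) E). }
  rewrite norm_scal_C, Cmod_R, Rabs_minus_sym.
  assert (h1 := resolvent_bound t (Rs l u) Ht0).
  assert (h2 := resolvent_bound l u Hl).
  assert (h3 : norm (Rs t (Rs l u)) <= B).
  { eapply Rle_trans; [exact h1 |]. apply Rmult_le_compat_l; lra. }
  apply Rle_lt_trans with (Rabs (t - l) * (B + 1)).
  - apply Rmult_le_compat_l; [apply Rabs_pos | lra].
  - apply Rmult_lt_compat_r with (r := B + 1) in Ht2; [| lra].
    replace (eps / (B + 1) * (B + 1)) with (pos eps) in Ht2 by (field; lra).
    exact Ht2.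
Qed.

Variable a : R.
Hypothesis Ha : 0 < a < 1.

(** With u = J f this is the Balakrishnan integral of f without the factor sin(a pi)/pi; up to that
    factor, v is J^(a-1) u. *)
Definition resolvent_integral (u v : H) : Prop :=
  @is_RInt_gen HR (fun l => scal (Rpower l (a - 1)) (Rs l u : HR))
    (at_right 0) (Rbar_locally p_infty) v.

Lemma resolvent_integral_ex (u : H) : exists v, resolvent_integral u v /\
  norm v <= (2 * / a * K + / (1 - a)) * norm u.
Proof.
  destruct (is_RInt_gen_Rpower_scal (V := HR) (fun l => Rs l u) a
              (2 * K * norm u) (norm u)) as [v [Hv Nv]].
  - easy.
  - intros l Hl. now apply resolvent_continuous.
  - intros l Hl. now apply resolvent_bound.
  - intros l Hl. unfold Rdiv. rewrite Rmult_comm. now apply Rs_bound.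
  - exists v. split; [exact Hv |]. eapply Rle_trans; [exact Nv |].
    apply Req_le. field. lra.
Qed.

Lemma resolvent_integral_unique (u v w : H) :
  resolvent_integral u v -> resolvent_integral u w -> v = w.
Proof.
  intros Hv Hw.
  assert (FFa := Proper_StrongProper _ (at_right_proper_filter 0)).
  assert (FFb := Proper_StrongProper _ (Rbar_locally_filter p_infty)).
  set (f := fun l => scal (Rpower l (a - 1)) (Rs l u : HR)).
  transitivity (RInt_gen (V := HR) f (at_right 0) (Rbar_locally p_infty)).
  - symmetry. exact (is_RInt_gen_unique (V := HR) f v Hv).
  - exact (is_RInt_gen_unique (V := HR) f w Hw).
Qed.

(** Agreement for positive l suffices, since both endpoints are eventually positive; [Rs l] is
    unconstrained elsewhere. *)
Lemma resolvent_integral_ext (f g : R -> H) (v : H) :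
  (forall l, 0 < l -> f l = g l) ->
  @is_RInt_gen HR (f : R -> HR) (at_right 0) (Rbar_locally p_infty) v ->
  @is_RInt_gen HR (g : R -> HR) (at_right 0) (Rbar_locally p_infty) v.
Proof.
  intros Hfg. apply (is_RInt_gen_ext (V := HR) f g).
  exists (fun x => 0 < x) (fun y => 0 < y).
  - exists (mkposreal 1 Rlt_0_1). now intros.
  - now exists 0.
  - intros x y Hx Hy t [Ht _]. apply Hfg. simpl in Ht.
    apply Rlt_trans with (2 := Ht). now apply Rmin_glb_lt.
Qed.

Lemma resolvent_integral_minus (u u' v v' : H) :
  resolvent_integral u v -> resolvent_integral u' v' ->
  resolvent_integral (minus u u') (minus v v').
Proof.
  intros Hv Hv'. generalize (is_RInt_gen_minus (V := HR) _ _ _ _ Hv Hv').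
  apply resolvent_integral_ext. intros l Hl.
  assert (E : Rs l (minus u u') = minus (Rs l u) (Rs l u')).
  { unfold minus. rewrite (linear_plus (Rs l) (Rs_lin l Hl)). f_equal.
    exact (linear_opp (Rs l) u' (Rs_lin l Hl)). }
  rewrite E. symmetry.
  exact (scal_minus_distr_l (V := HR) (Rpower l (a - 1)) (Rs l u) (Rs l u')).
Qed.

Lemma resolvent_integral_A (u v : H) :
  resolvent_integral u v -> resolvent_integral (A u) (A v).
Proof.
  intros Hv.
  generalize (is_RInt_gen_linear (U := HR) (V := HR) A _ _ _ v
                (is_linear_real H A A_lin) Hv).
  apply resolvent_integral_ext. intros l Hl.
  rewrite resolvent_comm by easy.
  exact (linear_scal A A_lin (RtoC (Rpower l (a - 1))) (Rs l u)).
Qed.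

End FractionalPower.

(** The prefactor of the integral is at most 1, so the bound on the integral alone already yields
    [power_const]. *)
Lemma sin_PI_bounds (a : R) : 0 < a < 1 -> 0 <= sin (a * PI) / PI <= 1.
Proof.
  intros Ha. assert (hpi := PI2_1). assert (hb := SIN_bound (a * PI)).
  assert (hs : 0 <= sin (a * PI)) by (apply sin_ge_0; nra).
  split.
  - apply Rdiv_le_0_compat; lra.
  - apply Rmult_le_reg_r with PI; [lra |]. unfold Rdiv.
    rewrite Rmult_assoc, Rinv_l; lra.
Qed.

(** * The inverse of an m-accretive operator and the values of its power on the domain *)

Section Inverse.

Variable H : Hilbert.
Variables (J : operator H) (A : H -> H).
Hypothesis J_lin : linear_operator J.
Hypothesis J_acc : m_accretive J.
Hypothesis A_lin : is_linear A.
Hypothesis JA : forall f g, J f g <-> f = A g.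

Let K := op_norm (op_inv J).

Lemma op_inv_bound : 0 <= K /\ forall x, norm (A x) <= K * norm x.
Proof. apply op_norm_bound; [exact A_lin |]. intros f g. apply JA. Qed.

(** Injectivity of the inverse is single-valuedness of J. *)
Lemma inverse_inj x y : A x = A y -> x = y.
Proof.
  intros E. destruct J_lin as [_ [_ [_ Ju]]].
  apply (Ju (A x)); apply JA; [reflexivity | exact E].
Qed.

Lemma m_accretive_resolvent : exists Rs : R -> H -> H,
  forall l, 0 < l -> is_linear (Rs l) /\
    (forall x, norm (Rs l x) <= / l * norm x) /\
    (forall f g, op_add J (op_scalar (RtoC l)) g f <-> g = Rs l f).
Proof.
  apply (choice (fun l (B : H -> H) => 0 < l -> is_linear B /\
    (forall x, norm (B x) <= / l * norm x) /\
    (forall f g, op_add J (op_scalar (RtoC l)) g f <-> g = B f))).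
  intros l. destruct (Rlt_dec 0 l) as [Hl | Hl].
  - destruct (J_acc (RtoC l) Hl) as [[B [B_lin HB]] Hn].
    exists B. intros _. split; [easy |]. split; [| exact HB].
    intros x. destruct (op_norm_bound H _ B B_lin HB) as [_ h].
    eapply Rle_trans; [apply h |].
    apply Rmult_le_compat_r; [apply norm_ge_0 | exact Hn].
  (* A default for l <= 0, where nothing is required. *)
  - now exists (fun x => x).
Qed.

Section Resolvent.

Variable Rs : R -> H -> H.
Hypothesis HRs : forall l, 0 < l -> is_linear (Rs l) /\
    (forall x, norm (Rs l x) <= / l * norm x) /\
    (forall f g, op_add J (op_scalar (RtoC l)) g f <-> g = Rs l f).

Lemma resolvent_surj l f : 0 < l ->
  exists y, f = plus y (scal (RtoC l : C_AbsRing) (A y)).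
Proof.
  intros Hl. destruct (HRs l Hl) as [_ [_ h]].
  destruct (proj2 (h f (Rs l f)) eq_refl) as [y [z [Hy [Hz ->]]]].
  exists y. f_equal. apply JA in Hy. rewrite <- Hy. exact Hz.
Qed.

Lemma resolvent_inv l y : 0 < l ->
  Rs l (plus y (scal (RtoC l : C_AbsRing) (A y))) = A y.
Proof.
  intros Hl. destruct (HRs l Hl) as [_ [_ h]]. symmetry. apply h.
  exists y, (scal (RtoC l : C_AbsRing) (A y)).
  split; [now apply JA | now split].
Qed.

(* [l |A y| <= |y + l A y|] for all [l > 0] forces [Re (y, A y) >= 0]. *)
Lemma inverse_accretive y : 0 <= Re (inner y (A y)).
Proof.
  apply Rnot_lt_le. intros Hneg.
  assert (Hl0 : forall l, 0 < l ->
    0 <= norm y ^ 2 + 2 * (l * Re (inner y (A y)))).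
  { intros l Hl. destruct (HRs l Hl) as [_ [hb _]].
    specialize (hb (plus y (scal (RtoC l : C_AbsRing) (A y)))).
    rewrite resolvent_inv in hb by exact Hl.
    apply Rmult_le_compat_l with (r := l) in hb; [| lra].
    rewrite <- Rmult_assoc, Rinv_r, Rmult_1_l in hb by lra.
    assert (N : 0 <= norm (A y)) by apply norm_ge_0.
    assert (hsq : (l * norm (A y)) ^ 2 <=
      norm (plus y (scal (RtoC l : C_AbsRing) (A y))) ^ 2)
      by (apply pow_incr; split; [nra | exact hb]).
    rewrite norm_plus_sq, norm_scal_C, Cmod_R, Rabs_pos_eq in hsq by lra.
    rewrite inner_scal_r in hsq.
    replace (Re (Cmult (Cconj (RtoC l)) (inner y (A y))))
      with (l * Re (inner y (A y))) in hsq
      by (unfold Re, Cmult, Cconj, RtoC; simpl; ring).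
    lra. }
  set (r := Re (inner y (A y))) in *.
  assert (N : 0 <= norm y ^ 2) by apply pow2_ge_0.
  (* With this l, l r = -(|y|^2 + 1), so the right side of [Hl0] becomes -|y|^2 - 2 < 0. *)
  assert (Hl : 0 < (norm y ^ 2 + 1) / (- r)) by (apply Rdiv_lt_0_compat; lra).
  specialize (Hl0 _ Hl).
  replace ((norm y ^ 2 + 1) / - r * r) with (- (norm y ^ 2 + 1)) in Hl0
    by (field; lra).
  lra.
Qed.

(** Let v = y + A y be orthogonal to the range of A. Pairing with A y gives Re (y, A y) + |A y|^2 =
    0, a sum of nonnegative terms, so A y = 0 and then y = 0. *)
Lemma inverse_dense : dense_set (fun h => exists f, h = A f).
Proof.
  apply dense_of_orthogonal.
  - split; [| split].
    + exists zero. symmetry. exact (linear_zero A A_lin).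
    + intros x y [x' ->] [y' ->]. exists (plus x' y').
      symmetry. apply (linear_plus A A_lin).
    + intros c x [x' ->]. exists (scal c x').
      symmetry. exact (linear_scal A A_lin c x').
  - intros v Hv. destruct (resolvent_surj 1 v Rlt_0_1) as [y Hy].
    assert (h := Hv (A y) (ex_intro _ y eq_refl)).
    rewrite Hy, inner_plus_r, inner_scal_r in h.
    apply (f_equal Re) in h. rewrite Re_plus in h.
    replace (Re (Cmult (Cconj (RtoC 1)) (inner (A y) (A y))))
      with (norm (A y) ^ 2) in h
      by (rewrite <- Re_inner_self; unfold Re, Cmult, Cconj, RtoC; simpl; ring).
    rewrite (inner_conj y (A y)), Re_Cconj in h. change (Re 0) with 0 in h.
    assert (hp := inverse_accretive y).
    assert (hz : A y = zero).
    { apply norm_0_eq. assert (N : 0 <= norm (A y)) by apply norm_ge_0. nra. }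
    assert (y0 : y = zero).
    { apply inverse_inj. rewrite hz. symmetry. exact (linear_zero A A_lin). }
    rewrite Hy, hz, y0.
    transitivity (plus (zero : H) zero); [f_equal | exact (plus_zero_l (G := H) zero)].
    exact (scal_zero_r (V := H) _).
Qed.

Lemma balakrishnan_range (a : R) (u h : H) :
  balakrishnan a J (A u) h <->
  exists v, resolvent_integral H Rs a u v /\
            h = scal (RtoC (sin (a * PI) / PI) : C_AbsRing) v.
Proof.
  split.
  - intros [phi [v [Hphi [Hv ->]]]]. exists v. split; [| reflexivity].
    revert Hv. apply resolvent_integral_ext. intros l Hl.
    destruct (HRs l Hl) as [_ [_ hR]].
    destruct (Hphi l Hl) as [g [Hg Hl']].
    apply JA in Hg. apply inverse_inj in Hg. subst g.
    apply hR in Hl'. now rewrite Hl'.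
  - intros [v [Hv ->]]. exists (fun l => Rs l u), v. split; [| now split].
    intros l Hl. exists u. split; [now apply JA |].
    destruct (HRs l Hl) as [_ [_ hR]]. now apply hR.
Qed.

End Resolvent.

(* [A] commutes with the integral and is injective, so a limit of
   [(A u_n, J^a A u_n)] with [A u_n] converging to [A u] is determined by [u]:
   this is the closability of [J^a]. *)
Lemma op_power_range (a : R) : 0 <= a < 1 ->
  exists T : H -> H,
    (forall u w, op_power a J (A u) w <-> w = T u) /\
    forall u, norm (T u) <= power_const a J * norm u.
Proof.
  intros Ha. destruct op_inv_bound as [K0 AK].
  unfold op_power, power_const. destruct (Req_EM_T a 0) as [Ea | Ea].
  (* For a = 0 the power is the identity, so its value at [A u] is [A u], and [power_const] is the
     norm of J^(-1). *)
  { exists A. now split. }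
  assert (Ha' : 0 < a < 1) by lra.
  fold K. set (C := 2 * / a * K + / (1 - a)).
  destruct m_accretive_resolvent as [Rs HRs].
  assert (R_lin : forall l, 0 < l -> is_linear (Rs l)) by (intros; now apply HRs).
  assert (R_bd : forall l x, 0 < l -> norm (Rs l x) <= / l * norm x)
    by (intros; now apply HRs).
  assert (R_surj := resolvent_surj Rs HRs).
  assert (R_inv := resolvent_inv Rs HRs).
  assert (ex : forall u, exists v, resolvent_integral H Rs a u v /\
                 norm v <= C * norm u)
    by (intros u; now apply (resolvent_integral_ex H A K Rs)).
  destruct (choice _ ex) as [S HS].
  assert (S_uniq : forall u v, resolvent_integral H Rs a u v -> v = S u).
  { intros u v Hv. apply (resolvent_integral_unique H Rs a u v (S u) Hv), HS. }
  destruct (sin_PI_bounds a Ha') as [s0 s1].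
  set (s := sin (a * PI) / PI) in *.
  set (sC := RtoC s : C_AbsRing).
  assert (C0 : 0 <= C).
  { unfold C. assert (0 < / a) by (apply Rinv_0_lt_compat; lra).
    assert (0 < / (1 - a)) by (apply Rinv_0_lt_compat; lra). nra. }
  set (T := (fun u => scal sC (S u)) : H -> H).
  assert (NT : forall u, norm (T u) <= C * norm u).
  { intros u. unfold T, sC. rewrite norm_scal_C, Cmod_R, Rabs_pos_eq by lra.
    assert (0 <= norm (S u)) by apply norm_ge_0.
    assert (h := proj2 (HS u)). nra. }
  assert (bal : forall u h, balakrishnan a J (A u) h <-> h = T u).
  { intros u h. rewrite (balakrishnan_range Rs HRs). split.
    - intros [v [Hv ->]]. now rewrite (S_uniq u v Hv).
    - intros ->. exists (S u). split; [apply HS | reflexivity]. }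
  assert (AT : forall x, A (T x) = T (A x)).
  { intros x. transitivity (scal sC (A (S x))).
    - exact (linear_scal A A_lin sC (S x)).
    - unfold T. f_equal. apply S_uniq.
      apply (resolvent_integral_A H A Rs A_lin R_surj R_inv), HS. }
  assert (Tm : forall x y, minus (T x) (T y) = T (minus x y)).
  { intros x y. transitivity (scal sC (minus (S x) (S y))).
    - symmetry. exact (scal_minus_distr_l (V := H) sC _ _).
    - unfold T. f_equal. apply S_uniq.
      apply (resolvent_integral_minus H Rs R_lin); apply HS. }
  assert (zero_dist : forall x : H, norm (minus x x) = 0).
  { intros x. replace (minus x x) with (zero : H); [exact (norm_zero (V := H)) |].
    symmetry. exact (minus_eq_zero (G := H) x). }
  exists T. split; [| exact NT].
  intros u w. split.
  2:{ intros ->. intros eps. exists (A u), (T u).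
      split; [now apply bal |]. rewrite !zero_dist. split; apply eps. }
  (* Compare A w with A T u through A T k, where (A k, T k) approximates (A u, w). The first gap is
     at most K e; the second equals |T (A k - A u)| <= C e because A and T commute. *)
  intros Hw. apply inverse_inj. apply eq_of_norm_small with (K + C).
  intros e He. destruct (Hw (mkposreal e He)) as [f' [g' [Hb [Hf Hg]]]].
  simpl in Hf, Hg.
  (* The integrand at l = 1 already requires f' to lie in the domain of J. *)
  assert (Hk : exists k, f' = A k).
  { destruct Hb as [phi [v [Hphi _]]]. destruct (Hphi 1 Rlt_0_1) as [k [Hk _]].
    exists k. now apply JA. }
  destruct Hk as [k ->]. apply bal in Hb. subst g'.
  eapply Rle_trans; [apply norm_minus_trans with (z := A (T k)) |].
  rewrite <- (bounded_linear_minus H A w _ A_lin), !AT, Tm.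
  assert (h1 := AK (minus w (T k))).
  assert (h2 := NT (minus (A k) (A u))).
  rewrite norm_minus_sym in Hf.
  nra.
Qed.

End Inverse.

(** * The energy space and the form of L *)

Theorem theorem2 (H : Hilbert) (alpha : R) (J F G : operator H) (gammaG : R)
    (Hsep : separable H)
    (Halpha : 0 <= alpha < 1)
    (HJ_lin : linear_operator J)
    (HJ_acc : m_accretive J)
    (HJ_cpt : compact_operator (op_inv J))
    (HF : bounded_operator F)
    (HG_lin : linear_operator G)
    (HG_bd : bounded_on_domain G)
    (HG_acc : strictly_accretive G gammaG)
    (HG_dom : forall f, op_ran J f -> op_dom G f)
    (HG_low : power_const alpha J * op_norm (op_inv J) * op_norm F < gammaG) :
  exists (Hp : Hilbert) (i : Hp -> H) (M : Hp -> Prop),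
    (compact_dense_inclusion i /\ linear_manifold M /\ dense_set M /\
     forall f, M f -> op_dom (Z_transform alpha G F J) (i f)) /\
    (exists C1 C2 : R, 0 < C1 /\ 0 < C2 /\
     forall (f g : Hp) (h : H), M f -> M g ->
       Z_transform alpha G F J (i f) h ->
       Cmod (inner h (i g)) <= C1 * norm f * norm g /\
       C2 * norm f ^ 2 <= Re (inner h (i f))).
Proof.
  destruct HJ_cpt as [[A [A_lin HA]] A_cpt].
  assert (JA : forall f g, J f g <-> f = A g) by (intros f g; apply (HA g f)).
  destruct (op_inv_bound H J A A_lin JA) as [K0 AK].
  assert (A_inj := inverse_inj H J A HJ_lin JA).
  destruct (m_accretive_resolvent H J HJ_acc) as [Rs HRs].
  assert (A_dense := inverse_dense H J A HJ_lin A_lin JA Rs HRs).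
  destruct (op_power_range H J A HJ_lin HJ_acc A_lin JA alpha Halpha)
    as [T [HT TC]].
  destruct HF as [B [B_lin HB]].
  destruct (op_norm_bound H F B B_lin HB) as [F0 BF].
  (* Since A is defined everywhere, R(J) is all of H, and so is D(G). *)
  assert (HG : forall x, exists y, G x y)
    by (intros x; apply HG_dom; exists (A x); now apply JA).
  destruct (choice _ HG) as [G' HG'].
  destruct HG_lin as [_ [Gp [Gs Gu]]].
  destruct HG_bd as [c Hc]. destruct HG_acc as [g0 Gacc].
  assert (G_eq : forall x y, G x y <-> y = G' x).
  { intros x y. split; [intros h; now apply (Gu x) | now intros ->]. }
  assert (G_lin : is_linear G').
  { split.
    - intros x y. symmetry. apply G_eq. now apply Gp.
    - intros k x. symmetry. apply G_eq. now apply Gs.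
    (* [is_linear] asks for a positive constant, while [c] may have any sign. *)
    - exists (Rabs c + 1). assert (hc := Rabs_pos c). split; [lra |]. intros x.
      eapply Rle_trans; [apply (Hc x); apply HG' |].
      assert (0 <= norm x) by apply norm_ge_0. assert (h := Rle_abs c). nra. }
  destruct (coercive_surjective H G' gammaG G_lin g0) as [G_low G_surj].
  { intros x. now apply Gacc. }
  set (P := power_const alpha J) in *.
  set (K := op_norm (op_inv J)) in *. set (N := op_norm F) in *.
  (* [D(J)] with the norm [|J f|] is [H] itself, included through [A]. *)
  exists H, A, (fun g => exists h, forall k, inner k (G' g) = inner (A k) h).
  split.
  { split; [| split; [| split]].
    - split; [exact A_lin |]. split; [exact A_inj |]. split; [exact A_dense |].
      intros E HE u Hu. apply (A_cpt E HE). intros n.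
      destruct (Hu n) as [f [Ef Hf]]. exists f. split; [easy |]. now apply HA.
    - split; [| split].
      + exists zero. intros k. rewrite inner_zero_r.
        transitivity (inner k zero);
          [f_equal; exact (linear_zero G' G_lin) | apply inner_zero_r].
      + intros x y [hx Hx] [hy Hy]. exists (plus hx hy). intros k.
        rewrite (linear_plus G' G_lin), !inner_plus_r. now rewrite Hx, Hy.
      + intros a x [hx Hx]. exists (scal a hx). intros k.
        transitivity (inner k (scal (a : C_AbsRing) (G' x)));
          [f_equal; exact (linear_scal G' G_lin a x) |].
        rewrite inner_scal_r, Hx. symmetry. exact (inner_scal_r H a (A k) hx).
    (* The range of the adjoint is dense because A is injective: v orthogonal to it is orthogonal to
       the adjoint applied to A v, which says |A v|^2 = 0. *)
    - assert (W_dense : dense_set (fun w : H =>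
        exists h, forall k, inner k w = inner (A k) h)).
      { apply dense_of_orthogonal.
        - split; [| split].
          + exists zero. intros k. now rewrite !inner_zero_r.
          + intros x y [hx Hx] [hy Hy]. exists (plus hx hy). intros k.
            now rewrite !inner_plus_r, Hx, Hy.
          + intros a x [hx Hx]. exists (scal a hx). intros k.
            transitivity (Cmult (Cconj a) (inner k x));
              [exact (inner_scal_r H a k x) |].
            rewrite Hx. symmetry. exact (inner_scal_r H a (A k) hx).
        - intros v Hv. apply A_inj.
          destruct (exists_adjoint H A A_lin (A v)) as [w Hw].
          assert (h : inner w v = 0) by (apply Hv; exists (A v); now intros).
          assert (h' := Hw v). rewrite (inner_conj w v), h in h'.
          apply (f_equal Re) in h'. rewrite Re_inner_self, Re_Cconj in h'.
          change (Re 0) with 0 in h'.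
          transitivity (zero : H); [| symmetry; exact (linear_zero A A_lin)].
          apply norm_0_eq. simpl in h'.
          destruct (Rmult_integral _ _ h') as [| h'']; [easy | lra]. }
      intros x eps.
      (* Approximate G x by G y in the dense range; the lower bound of G turns the error gammaG eps
         into eps for x - y. *)
      assert (He : 0 < gammaG * eps) by (apply Rmult_lt_0_compat; [easy | apply eps]).
      destruct (W_dense (G' x) (mkposreal _ He)) as [w [Ww Hw]].
      destruct (G_surj w) as [y <-]. exists y. split; [exact Ww |].
      change (norm (minus (G' x) (G' y)) < gammaG * eps) in Hw.
      rewrite <- (bounded_linear_minus H G' x y G_lin) in Hw.
      specialize (G_low (minus x y)).
      apply Rmult_lt_reg_l with gammaG; [easy |].
      exact (Rle_lt_trans _ _ _ G_low Hw).
    (* The witness [h] of membership in M is the adjoint of J applied to G f: [Hh] is the adjoint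
       relation tested on the pairs (A k, k) of the graph of J. *)
    - intros f [h Hh]. exists (plus h (B (T f))), h, (B (T f)).
      split; [| split; [| reflexivity]].
      + exists (G' f). split.
        * exists f. split; [now apply JA | apply HG'].
        * intros x k Hxk. apply JA in Hxk. subst x. apply Hh.
      + exists (T f). split; [now apply HT | now apply HB]. }
  (* The value [h] is arbitrary; injectivity of A and uniqueness of the values of G, F and the power
     identify its pieces. The adjoint part is tested on the pair (A g, g). *)
  assert (form : forall f g h, Z_transform alpha G F J (A f) h ->
    inner h (A g) = Cplus (inner (G' f) g) (inner (B (T f)) (A g))).
  { intros f g h [h1 [h2 [[y [[x [Hx Hy]] Hh1]] [[z [Hz Hh2]] ->]]]].
    apply JA, A_inj in Hx. subst x. apply G_eq in Hy. subst y.
    apply HT in Hz. subst z. apply HB in Hh2. unfold op_graph in Hh2. subst h2.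
    rewrite inner_plus. f_equal.
    rewrite (inner_conj (A g) h1), <- (Hh1 (A g) g) by now apply JA.
    symmetry. apply inner_conj. }
  assert (pert : forall f g,
    Cmod (inner (B (T f)) (A g)) <= P * K * N * norm f * norm g).
  { intros f g. eapply Rle_trans; [apply cauchy_schwarz |].
    apply Rle_trans with (N * (P * norm f) * (K * norm g)); [| lra].
    apply Rmult_le_compat; [apply norm_ge_0 | apply norm_ge_0 | | apply AK].
    eapply Rle_trans; [apply BF |]. apply Rmult_le_compat_l; [exact F0 | apply TC]. }
  assert (hc := Rabs_pos c). assert (hc' := Rle_abs c).
  assert (hp := Rabs_pos (P * K * N)). assert (hp' := Rle_abs (P * K * N)).
  (* The absolute values and the 1 make the upper constant positive; the lower one is the margin
     left by [HG_low]. *)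
  exists (Rabs c + Rabs (P * K * N) + 1), (gammaG - P * K * N).
  split; [lra |]. split; [lra |].
  intros f g h _ _ Hh. rewrite !(form f _ h Hh).
  assert (Nf : 0 <= norm f) by apply norm_ge_0.
  assert (Ng : 0 <= norm g) by apply norm_ge_0.
  split.
  - eapply Rle_trans; [apply Cmod_triangle |].
    assert (h1 := cauchy_schwarz H (G' f) g). assert (h2 := pert f g).
    assert (h3 := Hc f (G' f) (HG' f)).
    assert (h4 : 0 <= norm f * norm g) by now apply Rmult_le_pos.
    apply Rmult_le_compat_r with (r := norm g) in h3; [| exact Ng].
    nra.
  - rewrite Re_plus.
    assert (h1 := Gacc f (G' f) (HG' f)). assert (h2 := pert f f).
    assert (h3 := Re_le_Cmod (Copp (inner (B (T f)) (A f)))).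
    rewrite Cmod_opp in h3.
    change (Re (Copp (inner (B (T f)) (A f))))
      with (- Re (inner (B (T f)) (A f))) in h3.
    lra.
Qed.
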